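(* Let $T$ be an infinite set and $R_{T.3}=\mathbf{R}^{(T^3)}=\mathbf{R}^T\times\mathbf{R}^T\times\mathbf{R}^T$, whose cells are $\mathbf{I}[\mathbf{N}]=I^1[N^1]\times I^2[N^2]\times I^3[N^3]$ with $\mathbf{N}=(N^1,N^2,N^3)$ and the $N^j\in\mathcal{N}(T)$ chosen independently. For $j=1,2,3$ let $L^j:\bar{\mathbf{R}}^T\to\mathcal{N}(T)$ be functions and $\delta^j_t:\bar{\mathbf{R}}\to\,]0,\infty[$ ($t\in T$) gauges in $\mathbf{R}$; let $\mathbf{L}(\mathbf{x})=(L^1(x^1_T),L^2(x^2_T),L^3(x^3_T))$ and $\gamma=(\mathbf{L},\{\delta^j_t\}_{t\in T,\,j=1,2,3})$. Then there exists a $\gamma$-fine division of $R_{T.3}$.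
   Context: $\mathcal{N}(T)$ is the family of finite subsets of $T$. A cell of $\mathbf{R}$ is $]u,v]$ ($u<v$ real), $]-\infty,v]$, or $]u,\infty[$; $y\in\bar{\mathbf{R}}=[-\infty,\infty]$ is associated with $I$ if $y$ is a vertex of $I$; for a gauge $\delta$ in $\mathbf{R}$, an associated $(y,I)$ is $\delta$-fine if: $I$ bounded and $|I|<\delta(y)$; or $y=-\infty$, $I=\,]-\infty,v]$, $v<-1/\delta(y)$; or $y=+\infty$, $I=\,]u,\infty[$, $u>1/\delta(y)$. Points of $R_{T.3}$ are $\mathbf{x}=(x^1_T,x^2_T,x^3_T)$ with $x^j_T=(x^j_t)_{t\in T}$ (tags in $(\bar{\mathbf{R}}^T)^3$). For each $j$, $I^j[N^j]=\prod_{t\in N^j}I^j_t\times\mathbf{R}^{T\setminus N^j}$ with each $I^j_t$ a cell of $\mathbf{R}$. $(\mathbf{x},\mathbf{I}[\mathbf{N}])$ is associated if $(x^j_t,I^j_t)$ is associated for all $j$ and $t\in N^j$; it is $\gamma$-fine if, for $j=1,2,3$, $N^j\supseteq L^j(x^j_T)$ and $(x^j_t,I^j_t)$ is $\delta^j_t$-fine for every $t\in N^j$. A division is a finite collection of associated pairs whose cells are pairwise disjoint with union $R_{T.3}$; it is $\gamma$-fine if every pair is. *)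

(* Defs.v *)
From Stdlib Require Import Reals List.
Open Scope R_scope.

Inductive Rbar : Type := Fin (r : R) | PInf | NInf.

(** Cells of R: ]u,v] (u<v), ]-oo,v], ]u,oo[. *)
Inductive Cell : Type :=
  | CBd (u v : R)
  | CLeft (v : R)
  | CRight (u : R).

Definition cell_ok (I : Cell) : Prop :=
  match I with CBd u v => u < v | _ => True end.

Definition in_cell (z : R) (I : Cell) : Prop :=
  match I with
  | CBd u v => u < z /\ z <= v
  | CLeft v => z <= v
  | CRight u => u < z
  end.

Definition associated (y : Rbar) (I : Cell) : Prop :=
  match I with
  | CBd u v => y = Fin u \/ y = Fin v
  | CLeft v => y = NInf \/ y = Fin v
  | CRight u => y = Fin u \/ y = PInf
  end.

Definition dfine (delta : Rbar -> R) (y : Rbar) (I : Cell) : Prop :=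
  match I with
  | CBd u v => v - u < delta y
  | CLeft v => y = NInf /\ v < - / delta y
  | CRight u => y = PInf /\ u > / delta y
  end.

(** The three factors j = 1,2,3 of R_{T.3}. *)
Inductive J3 : Type := J1 | J2 | J3c.

(** A cell I[N] = I^1[N^1] x I^2[N^2] x I^3[N^3]: the finite sets N^j are
    lists of elements of T, and I j t is the cell I^j_t (relevant for t in N^j). *)
Record BCell (T : Type) : Type := mkBCell {
  bN : J3 -> list T;
  bI : J3 -> T -> Cell }.
Arguments bN {T}. Arguments bI {T}.

Definition bcell_ok {T} (C : BCell T) : Prop :=
  forall j t, In t (bN C j) -> cell_ok (bI C j t).

Definition in_bcell {T} (z : J3 -> T -> R) (C : BCell T) : Prop :=
  forall j t, In t (bN C j) -> in_cell (z j t) (bI C j t).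

Definition Tag (T : Type) := J3 -> T -> Rbar.

Definition assoc_pair {T} (x : Tag T) (C : BCell T) : Prop :=
  forall j t, In t (bN C j) -> associated (x j t) (bI C j t).

Definition gamma_fine {T} (L : J3 -> (T -> Rbar) -> list T)
  (delta : J3 -> T -> Rbar -> R) (x : Tag T) (C : BCell T) : Prop :=
  forall j,
    (forall t, In t (L j (x j)) -> In t (bN C j)) /\
    (forall t, In t (bN C j) -> dfine (delta j t) (x j t) (bI C j t)).

Definition division {T} (D : list (Tag T * BCell T)) : Prop :=
  (forall p, In p D -> bcell_ok (snd p) /\ assoc_pair (fst p) (snd p)) /\
  (forall i k, (i < length D)%nat -> (k < length D)%nat -> i <> k ->
     forall d (z : J3 -> T -> R),
       ~ (in_bcell z (snd (nth i D d)) /\ in_bcell z (snd (nth k D d)))) /\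
  (forall z : J3 -> T -> R, exists p, In p D /\ in_bcell z (snd p)).

Definition gamma_fine_division {T} L delta (D : list (Tag T * BCell T)) : Prop :=
  division D /\ forall p, In p D -> gamma_fine L delta (fst p) (snd p).

Definition infinite_type (T : Type) : Prop :=
  ~ exists l : list T, forall t : T, In t l.

(* Main.v *)
Require Import Defs.
From Stdlib Require Import Reals List.
From Stdlib Require Import Lra Lia Classical ClassicalEpsilon.
From mathcomp Require classical_sets.
Open Scope R_scope.

(** Fix, on some set of coordinates (j,t), a fine associated pair (y,I) for each of
    them; call such a partial assignment divisible if finitely many of its
    coordinates cut out a box covered by disjoint fine cells whose tags and edges
    agree with the assignment.  If an assignment is not divisible, then Cousin's
    lemma in one further coordinate extends it to a larger assignment that is not
    divisible.  Divisibility involves finitely many coordinates only, so Zorn's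
    lemma applies to the non-divisible assignments.  A maximal one would be total,
    i.e. a tag x together with a fine pair in every coordinate, and then the single
    cell restricted on L(x) divides it.  Hence the empty assignment is divisible. *)

(** * Lists with pairwise related entries *)

Lemma ForallOrdPairs_app {A : Type} (R : A -> A -> Prop) (l1 l2 : list A) :
  ForallOrdPairs R l1 -> ForallOrdPairs R l2 ->
  (forall a b, In a l1 -> In b l2 -> R a b) -> ForallOrdPairs R (l1 ++ l2).
Proof.
  intros H1 H2 H12. induction H1 as [|a l Ha Hl IH]; simpl; [exact H2|].
  constructor.
  - apply Forall_app; split; [exact Ha|].
    apply Forall_forall. intros b Hb. apply H12; simpl; auto.
  - apply IH. intros; apply H12; simpl; auto.
Qed.

Lemma ForallOrdPairs_map {A B : Type} (R : A -> A -> Prop) (R' : B -> B -> Prop)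
  (f : A -> B) (l : list A) :
  (forall a b, R a b -> R' (f a) (f b)) ->
  ForallOrdPairs R l -> ForallOrdPairs R' (map f l).
Proof.
  intros Hf H. induction H as [|a l Ha Hl IH]; simpl; constructor; auto.
  apply Forall_map. eapply Forall_impl; [|exact Ha]. auto.
Qed.

(** Passes to the indexed form of disjointness in [division]; symmetry supplies the pairs taken in
    reverse order. *)
Lemma ForallOrdPairs_nth {A : Type} (R : A -> A -> Prop) (l : list A) (d : A) :
  (forall a b, R a b -> R b a) -> ForallOrdPairs R l ->
  forall i k, (i < length l)%nat -> (k < length l)%nat -> i <> k ->
  R (nth i l d) (nth k l d).
Proof.
  intros Hsym H. induction H as [|a l Ha Hl IH]; simpl; intros i k Hi Hk Hik;
    [lia|].
  rewrite Forall_forall in Ha.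
  destruct i as [|i], k as [|k].
  - lia.
  - apply Ha, nth_In; lia.
  - apply Hsym, Ha, nth_In; lia.
  - apply IH; lia.
Qed.

(** * Cousin's lemma *)

Definition fine_tagged_cell (delta : Rbar -> R) (e : Rbar * Cell) : Prop :=
  cell_ok (snd e) /\ associated (fst e) (snd e) /\ dfine delta (fst e) (snd e).

Definition disjoint_cells (e e' : Rbar * Cell) : Prop :=
  forall z, ~ (in_cell z (snd e) /\ in_cell z (snd e')).

Definition fine_partition (delta : Rbar -> R) (P : R -> Prop)
  (E : list (Rbar * Cell)) : Prop :=
  (forall e, In e E -> fine_tagged_cell delta e) /\
  ForallOrdPairs disjoint_cells E /\
  (forall z, (exists e, In e E /\ in_cell z (snd e)) <-> P z).

Lemma fine_partition_cons (delta : Rbar -> R) (P Q : R -> Prop) e E :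
  fine_partition delta P E -> fine_tagged_cell delta e ->
  (forall z, in_cell z (snd e) -> ~ P z) ->
  (forall z, Q z <-> in_cell z (snd e) \/ P z) ->
  fine_partition delta Q (e :: E).
Proof.
  intros (Hf & Hd & Hc) He HeP HQ. split; [|split].
  - intros e' [<-|Hin]; auto.
  - constructor; [|exact Hd]. apply Forall_forall. intros e' He' z [Hz Hz'].
    apply (HeP z Hz), Hc; eauto.
  - intros z. rewrite HQ, <- Hc. split.
    + intros (e' & [<-|Hin] & Hz); eauto.
    + intros [Hz|(e' & Hin & Hz)]; [exists e|exists e']; simpl; auto.
Qed.

(** Supremum argument: the supremum [m] of the right ends reachable from [a] is itself reached by a
    cell tagged at [m], and a second cell tagged at [m] goes past it unless [m = b]. *)
Lemma Cousin_interval (delta : Rbar -> R) (a b : R) :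
  (forall y, 0 < delta y) -> a < b ->
  exists E, fine_partition delta (fun z => a < z <= b) E.
Proof.
  intros Hdelta Hab.
  set (P := fun c => a <= c <= b /\
              exists E, fine_partition delta (fun z => a < z <= c) E).
  assert (Hstep : forall c c' y, P c -> c < c' <= b -> c' - c < delta y ->
            y = Fin c \/ y = Fin c' -> P c').
  { intros c c' y [Hc [E HE]] Hc' Hd Hy. split; [lra|].
    exists ((y, CBd c c') :: E).
    eapply fine_partition_cons; [exact HE| | |].
    - repeat split; simpl; auto; lra.
    - simpl; intros z; lra.
    - simpl; intros z; lra. }
  assert (Ha : P a).
  { split; [lra|]. exists nil. split; [|split].
    - intros e [].
    - constructor.
    - intros z; split; [intros (e & [] & _)|lra]. }
  destruct (completeness P) as [m [Hub Hlub]].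
  { exists b. intros c [Hc _]; lra. }
  { exists a; exact Ha. }
  assert (Ham : a <= m) by (apply Hub, Ha).
  assert (Hmb : m <= b) by (apply Hlub; intros c [Hc _]; lra).
  pose proof (Hdelta (Fin m)) as Hm.
  assert (HPm : P m).
  { destruct (classic (exists c, P c /\ m - delta (Fin m) < c)) as [(c & Hc & Hcm)|Hno].
    - pose proof (Hub c Hc). destruct (Req_dec c m) as [<-|Hne]; [exact Hc|].
      apply (Hstep c m (Fin m)); auto; lra.
    - assert (m <= m - delta (Fin m)); [|lra].
      apply Hlub. intros c Hc. apply Rnot_lt_le. intros Hlt. apply Hno; eauto. }
  destruct (Req_dec m b) as [<-|Hne]; [exact (proj2 HPm)|].
  (* Half the gauge keeps the cell from [m] to [c] strictly fine; the minimum keeps it inside the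
     interval. *)
  set (c := Rmin b (m + delta (Fin m) / 2)).
  assert (Hc : m < c <= b /\ c - m < delta (Fin m)).
  { unfold c, Rmin. destruct (Rle_dec _ _); lra. }
  assert (c <= m); [|lra].
  apply Hub, (Hstep m c (Fin m)); auto; lra.
Qed.

Lemma Cousin (delta : Rbar -> R) :
  (forall y, 0 < delta y) -> exists E, fine_partition delta (fun _ => True) E.
Proof.
  intros Hdelta.
  (* The shift by 1 gives the strict inequalities that make the two unbounded cells fine at the
     infinite tags. *)
  set (a := - / delta NInf - 1). set (b := / delta PInf + 1).
  assert (Ha : a < 0).
  { unfold a. pose proof (Rinv_0_lt_compat _ (Hdelta NInf)); lra. }
  assert (Hb : 0 < b).
  { unfold b. pose proof (Rinv_0_lt_compat _ (Hdelta PInf)); lra. }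
  destruct (Cousin_interval delta a b Hdelta) as [E HE]; [lra|].
  exists ((NInf, CLeft a) :: (PInf, CRight b) :: E).
  apply (fine_partition_cons _ (fun z => a < z)).
  - eapply fine_partition_cons; [exact HE| | |].
    + repeat split; simpl; auto. unfold b; lra.
    + simpl; intros z; lra.
    + simpl; intros z; lra.
  - repeat split; simpl; auto. unfold a; lra.
  - simpl; intros z; lra.
  - simpl; intros z. split; [intros _; lra|trivial].
Qed.

(** * Divisible partial assignments *)

Section Assignments.

Variables (T : Type) (L : J3 -> (T -> Rbar) -> list T)
  (delta : J3 -> T -> Rbar -> R).
Hypothesis Hdelta : forall j t y, 0 < delta j t y.

(* The graph of a partial function from coordinates to tagged cells. *)
Definition assignment : Type := (J3 * T) * (Rbar * Cell) -> Prop.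

Definition functional (A : assignment) : Prop :=
  forall s e e', A (s, e) -> A (s, e') -> e = e'.

Definition fine_assignment (A : assignment) : Prop :=
  forall j t e, A ((j, t), e) -> fine_tagged_cell (delta j t) e.

Definition fine_pair (p : Tag T * BCell T) : Prop :=
  bcell_ok (snd p) /\ assoc_pair (fst p) (snd p) /\
  gamma_fine L delta (fst p) (snd p).

(** The edge is prescribed even where the cell is not restricted, i.e. for [t] outside [bN], so that
    a later restriction in that coordinate has the right edge. *)
Definition agrees (A : assignment) (p : Tag T * BCell T) : Prop :=
  forall j t e, A ((j, t), e) -> fst p j t = fst e /\ bI (snd p) j t = snd e.

Definition disjoint_bcells (p q : Tag T * BCell T) : Prop :=
  forall z, ~ (in_bcell z (snd p) /\ in_bcell z (snd q)).

(* Coordinates of F outside the domain of A impose no constraint. *)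
Definition in_box (A : assignment) (F : list (J3 * T)) (z : J3 -> T -> R) : Prop :=
  forall j t e, In (j, t) F -> A ((j, t), e) -> in_cell (z j t) (snd e).

(** The cells have to cover the box but may stick out of it. *)
Definition divisible (A : assignment) : Prop :=
  exists (F : list (J3 * T)) (D : list (Tag T * BCell T)),
    (forall p, In p D -> fine_pair p /\ agrees A p) /\
    ForallOrdPairs disjoint_bcells D /\
    (forall z, in_box A F z -> exists p, In p D /\ in_bcell z (snd p)).

Definition extend (A : assignment) (s : J3 * T) (e : Rbar * Cell) : assignment :=
  fun q => A q \/ q = (s, e).

(** * Restricting a cell in one more coordinate *)

Definition J3_eq_dec (i j : J3) : {i = j} + {i <> j}.
Proof. decide equality. Defined.

(** The tag is kept, hence so is the value of [L] at it: enlarging the restricted set cannot spoil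
    the inclusion required by [gamma_fine]. *)
Definition add_coordinate (j : J3) (t : T) (p : Tag T * BCell T) :
  Tag T * BCell T :=
  (fst p, mkBCell T
    (fun i => if J3_eq_dec i j then t :: bN (snd p) i else bN (snd p) i)
    (bI (snd p))).

Lemma In_add_coordinate j t p i u :
  In u (bN (snd (add_coordinate j t p)) i) <->
  (i, u) = (j, t) \/ In u (bN (snd p) i).
Proof.
  simpl. destruct (J3_eq_dec i j) as [->|Hne]; simpl.
  - split; intros [H|H]; auto; left; congruence.
  - split; [auto|intros [H|H]; [congruence|exact H]].
Qed.

Lemma in_bcell_add_coordinate j t p z :
  in_bcell z (snd (add_coordinate j t p)) <->
  in_cell (z j t) (bI (snd p) j t) /\ in_bcell z (snd p).
Proof.
  split.
  - intros H. split.
    + apply (H j t), In_add_coordinate; auto.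
    + intros i u Hu. apply (H i u), In_add_coordinate; auto.
  - intros [Hjt H] i u Hu. apply In_add_coordinate in Hu as [[= -> ->]|Hu].
    + exact Hjt.
    + exact (H i u Hu).
Qed.

Lemma fine_pair_add_coordinate j t p :
  fine_pair p -> fine_tagged_cell (delta j t) (fst p j t, bI (snd p) j t) ->
  fine_pair (add_coordinate j t p).
Proof.
  intros (Hok & Has & Hg) (Hok' & Has' & Hd'). split; [|split].
  - intros i u Hu. apply In_add_coordinate in Hu as [[= -> ->]|Hu];
      [exact Hok'|exact (Hok i u Hu)].
  - intros i u Hu. apply In_add_coordinate in Hu as [[= -> ->]|Hu];
      [exact Has'|exact (Has i u Hu)].
  - intros i. split.
    + intros u Hu. apply In_add_coordinate. right. apply (Hg i), Hu.
    + intros u Hu. apply In_add_coordinate in Hu as [[= -> ->]|Hu];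
        [exact Hd'|exact (proj2 (Hg i) u Hu)].
Qed.

(** * Extending an assignment by one coordinate *)

(** Induction on [E]. The cells dividing the extension by [e] may leave the slab over [e], so they
    are first cut in coordinate [(j, t)]; families over different [e] are then disjoint and can be
    concatenated. The third clause carries this confinement through the induction. *)
Lemma divisible_partial_extensions (A : assignment) j t (E : list (Rbar * Cell)) :
  (forall e, In e E -> fine_tagged_cell (delta j t) e) ->
  ForallOrdPairs disjoint_cells E ->
  (forall e, In e E -> divisible (extend A (j, t) e)) ->
  exists F D,
    (forall p, In p D -> fine_pair p /\ agrees A p) /\
    ForallOrdPairs disjoint_bcells D /\
    (forall p, In p D -> exists e, In e E /\
       forall z, in_bcell z (snd p) -> in_cell (z j t) (snd e)) /\
    (forall z, in_box A F z -> (exists e, In e E /\ in_cell (z j t) (snd e)) ->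
       exists p, In p D /\ in_bcell z (snd p)).
Proof.
  intros Hfine Hdisj. induction Hdisj as [|e E HeE HE IH]; intros Hdiv.
  { exists nil, nil. split; [|split; [|split]].
    - intros p [].
    - constructor.
    - intros p [].
    - intros z _ (e & [] & _). }
  destruct IH as (F2 & D2 & Hf2 & Hd2 & Hin2 & Hc2).
  { intros; apply Hfine; simpl; auto. }
  { intros; apply Hdiv; simpl; auto. }
  destruct (Hdiv e) as (F1 & D1 & Hf1 & Hd1 & Hc1); [simpl; auto|].
  assert (Hcell : forall p, In p D1 -> fst p j t = fst e /\ bI (snd p) j t = snd e).
  { intros p Hp. apply (Hf1 p Hp). right; reflexivity. }
  assert (Hin1 : forall p, In p D1 -> forall z,
            in_bcell z (snd (add_coordinate j t p)) <->
            in_cell (z j t) (snd e) /\ in_bcell z (snd p)).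
  { intros p Hp z. rewrite in_bcell_add_coordinate, (proj2 (Hcell p Hp)).
    reflexivity. }
  exists (F1 ++ F2), (map (add_coordinate j t) D1 ++ D2).
  split; [|split; [|split]].
  - intros p Hp. apply in_app_or in Hp as [Hp|Hp]; [|auto].
    apply in_map_iff in Hp as (q & <- & Hq).
    destruct (Hf1 q Hq) as [Hq1 Hq2]. split.
    + apply fine_pair_add_coordinate; [exact Hq1|].
      destruct (Hcell q Hq) as [-> ->]. rewrite <- surjective_pairing.
      apply Hfine; simpl; auto.
    + intros i u e' He'. apply Hq2. left; exact He'.
  - apply ForallOrdPairs_app; [|exact Hd2|].
    + revert Hd1. apply ForallOrdPairs_map. intros p q Hpq z [Hp Hq].
      apply in_bcell_add_coordinate in Hp, Hq. apply (Hpq z). tauto.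
    + intros p p' Hp Hp' z [Hz Hz'].
      apply in_map_iff in Hp as (q & <- & Hq).
      apply (Hin1 q Hq) in Hz as [Hz _].
      destruct (Hin2 p' Hp') as (e' & He' & Hz'').
      rewrite Forall_forall in HeE. apply (HeE e' He' (z j t)). auto.
  - intros p Hp. apply in_app_or in Hp as [Hp|Hp].
    + apply in_map_iff in Hp as (q & <- & Hq).
      exists e. split; [simpl; auto|]. intros z Hz. apply (Hin1 q Hq z), Hz.
    + destruct (Hin2 p Hp) as (e' & He' & Hz). exists e'. simpl; auto.
  - intros z Hbox (e' & [<-|He'] & Hz).
    + destruct (Hc1 z) as (p & Hp & Hzp).
      (* The box of the extension adds only the condition in [(j, t)], which holds because [z] lies
         over [e]. *)
      * intros i u e' Hu [He'|[= -> -> ->]]; [|exact Hz].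
        apply (Hbox i u e'); [apply in_or_app; auto|exact He'].
      * exists (add_coordinate j t p). split.
        -- apply in_or_app; left. apply in_map, Hp.
        -- apply (Hin1 p Hp z). auto.
    + destruct (Hc2 z) as (p & Hp & Hzp).
      * intros i u e'' Hu He''.
        apply (Hbox i u e''); [apply in_or_app; auto|exact He''].
      * eauto.
      * exists p. split; [apply in_or_app; auto|exact Hzp].
Qed.

Lemma not_divisible_extend (A : assignment) j t :
  ~ divisible A ->
  exists e, fine_tagged_cell (delta j t) e /\ ~ divisible (extend A (j, t) e).
Proof.
  intros HA. destruct (Cousin (delta j t)) as (E & Hf & Hd & Hc); [auto|].
  apply NNPP. intros Hno. apply HA.
  destruct (divisible_partial_extensions A j t E) as (F & D & HD & HDd & _ & HDc);
    [exact Hf|exact Hd| |].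
  - intros e He. apply NNPP. intros Hne. apply Hno. exists e; auto.
  - exists F, D. split; [|split]; auto.
    intros z Hz. apply (HDc z Hz), Hc. trivial.
Qed.

(** * Total assignments and unions of chains *)

Lemma divisible_total (A : assignment) :
  fine_assignment A -> functional A -> (forall s, exists e, A (s, e)) ->
  divisible A.
Proof.
  intros Hfine Hfun Htot.
  set (f := fun s => proj1_sig (constructive_indefinite_description _ (Htot s))).
  assert (Hf : forall s, A (s, f s)).
  { intros s. exact (proj2_sig (constructive_indefinite_description _ (Htot s))). }
  set (x := fun j t => fst (f (j, t))).
  set (N := fun j => L j (x j)).
  (* These are exactly the coordinates in which the single cell is restricted, so it contains the
     box. *)
  exists (map (pair J1) (N J1) ++ map (pair J2) (N J2) ++ map (pair J3c) (N J3c)).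
  exists ((x, mkBCell T N (fun j t => snd (f (j, t)))) :: nil).
  assert (Hft : forall j t, fine_tagged_cell (delta j t) (f (j, t))).
  { intros j t. apply Hfine, Hf. }
  split; [|split].
  - intros p [<-|[]]. split; [split; [|split]|].
    + intros j t _. apply Hft.
    + intros j t _. apply Hft.
    + intros j. split; [auto|]. intros t _. apply Hft.
    + intros j t e He. rewrite (Hfun _ _ _ He (Hf _)). split; reflexivity.
  - repeat constructor.
  - intros z Hz. eexists; split; [left; reflexivity|].
    intros j t Ht. apply (Hz j t (f (j, t))); [|apply Hf].
    rewrite !in_app_iff. destruct j; simpl in Ht; auto using in_map.
Qed.

(** Each coordinate of [F] has at most one value in [U], supplied by one member of the chain; the
    larger of two members serves both the new coordinate and the previous ones. *)
Lemma chain_finite_restriction (C : assignment -> Prop) (U : assignment)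
  (F : list (J3 * T)) :
  (exists A, C A) ->
  (forall A B, C A -> C B -> (forall q, A q -> B q) \/ (forall q, B q -> A q)) ->
  (forall q, U q <-> exists A, C A /\ A q) ->
  functional U ->
  exists A, C A /\ forall s e, In s F -> U (s, e) -> A (s, e).
Proof.
  intros Hne Hchain HU Hfun. induction F as [|s F (A & HA & HAF)].
  { destruct Hne as [A HA]. exists A. split; [exact HA|]. intros s e []. }
  destruct (classic (exists e, U (s, e))) as [[e He]|Hno].
  - destruct (proj1 (HU _) He) as (B & HB & HBe).
    assert (Hs : forall e', U (s, e') -> B (s, e')).
    { intros e' He'. rewrite (Hfun _ _ _ He' He). exact HBe. }
    destruct (Hchain A B HA HB) as [HAB|HBA]; [exists B|exists A];
      (split; [assumption|]); intros s' e' [<-|Hin] He'; auto.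
  - exists A. split; [exact HA|]. intros s' e' [<-|Hin] He'; [|auto].
    exfalso; apply Hno; eauto.
Qed.

(** Agreement passes to smaller assignments, and the box depends only on the values on [F]. *)
Lemma divisible_restrict (A U : assignment) F D :
  (forall q, A q -> U q) ->
  (forall s e, In s F -> U (s, e) -> A (s, e)) ->
  (forall p, In p D -> fine_pair p /\ agrees U p) ->
  ForallOrdPairs disjoint_bcells D ->
  (forall z, in_box U F z -> exists p, In p D /\ in_bcell z (snd p)) ->
  divisible A.
Proof.
  intros HAU HF Hf Hd Hc. exists F, D. split; [|split; [exact Hd|]].
  - intros p Hp. destruct (Hf p Hp) as [H1 H2]. split; [exact H1|].
    intros j t e He. apply H2, HAU, He.
  - intros z Hz. apply Hc. intros j t e Hjt He. apply (Hz j t e); auto.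
Qed.

(** * Zorn's lemma and the conclusion *)

Lemma divisible_empty : divisible (fun _ => False).
Proof.
  apply NNPP. intros Hempty.
  set (P := fun A : assignment =>
              functional A /\ fine_assignment A /\ ~ divisible A).
  destruct (@classical_sets.Zorn_bigcup _ P) as (A & (Hfun & Hfine & Hdiv) & Hmax).
  - intros C HC Hchain. set (U := classical_sets.bigcup C (fun X => X)).
    assert (HU : forall q, U q <-> exists A, C A /\ A q).
    { intros q. split; [intros [A HA Hq]|intros (A & HA & Hq)]; exists A; auto. }
    assert (HUfun : functional U).
    { intros s e e' He He'. apply HU in He as (A & HA & He).
      apply HU in He' as (B & HB & He').
      destruct (Hchain A B HA HB) as [HAB|HBA].
      - apply (proj1 (HC B HB) s); [apply HAB, He|exact He'].
      - apply (proj1 (HC A HA) s); [exact He|apply HBA, He']. }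
    split; [exact HUfun|split].
    + intros j t e He. apply HU in He as (A & HA & He).
      exact (proj1 (proj2 (HC A HA)) j t e He).
    + intros (F & D & HD).
      destruct (classic (exists A, C A)) as [Hne|Hno].
      * destruct (chain_finite_restriction C U F Hne Hchain HU HUfun)
          as (A & HA & HAF).
        apply (HC A HA).
        apply (divisible_restrict A U F D); try apply HD; [|exact HAF].
        intros q Hq. apply HU; eauto.
      (* The empty chain: its union has no values, so a division for it would divide the empty
         assignment. *)
      * apply Hempty.
        apply (divisible_restrict _ U F D); try apply HD; [intros q []|].
        intros s e _ He. apply HU in He as (A & HA & _). apply Hno; eauto.
  - apply Hdiv, divisible_total; [exact Hfine|exact Hfun|].
    intros [j t]. apply NNPP. intros Hno.
    destruct (not_divisible_extend A j t Hdiv) as (e & He & Hext).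
    apply (Hmax (extend A (j, t) e)).
    + split; [intros q Hq; left; exact Hq|].
      intros Hsub. apply Hno. exists e. apply Hsub. right; reflexivity.
    + split; [|split; [|exact Hext]].
      (* The extension stays single-valued because [A] has no value at [(j, t)]. *)
      * intros s e1 e2 [H1|[= -> ->]] [H2|H2].
        -- exact (Hfun _ _ _ H1 H2).
        -- injection H2 as -> ->. exfalso; apply Hno; eauto.
        -- exfalso; apply Hno; eauto.
        -- congruence.
      * intros i u e' [He'|[= -> -> ->]]; [exact (Hfine _ _ _ He')|exact He].
Qed.

End Assignments.

Theorem theorem6 (T : Type) (HT : infinite_type T)
  (L : J3 -> (T -> Rbar) -> list T)
  (delta : J3 -> T -> Rbar -> R)
  (Hdelta : forall j t y, 0 < delta j t y) :
  exists D : list (Tag T * BCell T), gamma_fine_division L delta D.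
Proof.
  destruct (divisible_empty T L delta Hdelta) as (F & D & HD & Hdisj & Hcov).
  exists D. split; [split; [|split]|].
  - intros p Hp. destruct (HD p Hp) as [(Hok & Has & _) _]. auto.
  - intros i k Hi Hk Hik d.
    apply (ForallOrdPairs_nth (disjoint_bcells T) D d); auto.
    intros p q Hpq z [Hp Hq]. apply (Hpq z); auto.
  (* The box of the empty assignment is the whole space. *)
  - intros z. apply Hcov. intros j t e _ [].
  - intros p Hp. apply (HD p Hp).
Qed.
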